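(* Let $n\ge3$ and let $A\in\mathbb C^{n\times n}$ be the arrowhead matrix with diagonal entries $a_1,\dots,a_n$, last column $[b_1,\dots,b_{n-1},a_n]^T$, last row $[c_1,\dots,c_{n-1},a_n]$, and all other entries zero. Then $A$ is dichotomous if and only if for some angle $\theta$ and distinct real $h_0,h_1$ either (a) for $j=1,\dots,n-1$, $$\arg b_j+\arg c_j=2\theta+\pi\ \text{ (not depending on } j),\qquad |b_j|=|c_j|,$$ and $\operatorname{Re}(e^{-i\theta}a_j)$ equals $h_0$ or $h_1$ for $j=1,\dots,n$, with both values attained; or (b) the conditions $\arg b_j+\arg c_j=2\theta+\pi$, $|b_j|=|c_j|$ and $\operatorname{Re}(e^{-i\theta}a_j)\in\{h_0,h_1\}$ hold for $j=1,\dots,n-1$, except for one missing $j=i$, and $$\operatorname{Re}(e^{-i\theta}a_i)=(1-t)h_0+th_1,\qquad \operatorname{Re}(e^{-i\theta}a_n)=th_0+(1-t)h_1,$$ $$|e^{-i\theta}b_i+e^{i\theta}\overline{c_i}|=2|h_1-h_0|\sqrt{t(1-t)}$$ for some $t\in(0,1)$.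
   Context: For $A\in\mathbb C^{n\times n}$, consider the minimal number, over all real $\theta$, of distinct eigenvalues attained by the Hermitian part of the rotated matrix $e^{i\theta}A$, where the Hermitian part of $X$ is $(X+X^* )/2$. $A$ is called dichotomous if this minimal number equals two. (Matrices for which it equals one are the essentially Hermitian matrices, i.e. linear combinations of a Hermitian matrix and the identity.) Arguments are understood modulo $2\pi$; by convention, the argument condition $\arg b_j+\arg c_j=2\theta+\pi$ is considered satisfied whenever $b_j=c_j=0$.
   Formalization: The right-hand side additionally requires that A is not essentially Hermitian: otherwise ''if'' fails, e.g. for A = diag(0,0,1), which satisfies (a) with θ = 0, h0 = 0, h1 = 1, but iA has zero Hermitian part, so the minimal number is one. *)

(* Defs.v *)
From HB Require Import structures.
From mathcomp Require Import all_boot all_order all_algebra.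
From mathcomp Require Import finmap.
From mathcomp Require Import all_classical all_reals all_analysis.
From mathcomp.real_closed Require Export complex.

Set Implicit Arguments.
Unset Strict Implicit.
Unset Printing Implicit Defensive.

Import Order.TTheory GRing.Theory Num.Theory.

Local Open Scope ring_scope.
Local Open Scope complex_scope.
Local Open Scope sesquilinear_scope.

Definition expi (R : realType) (theta : R) : R[i] := cos theta +i* sin theta.

(* Principal argument, with values in ]-pi, pi]; carg 0 is a junk value. *)
Definition carg (R : realType) (z : R[i]) : R :=
  let phi := acos (complex.Re z / complex.Re `|z|) in
  if 0 <= complex.Im z then phi else - phi.

Definition eq_mod2pi (R : realType) (x y : R) : Prop :=
  exists k : int, x = y + k%:~R * (2 * pi).

(* arg b + arg c = phi modulo 2 pi; arg 0 is undefined, so the condition fails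
   when exactly one of b, c vanishes, while it holds by convention when both
   do. *)
Definition arg_sum (R : realType) (b c : R[i]) (phi : R) : Prop :=
  (b = 0 /\ c = 0) \/
  [/\ b != 0, c != 0 & eq_mod2pi (carg b + carg c) phi].

Definition herm_part (R : realType) (n : nat) (X : 'M[R[i]]_n) : 'M[R[i]]_n :=
  2^-1 *: (X + X ^t*).

(* The set of eigenvalues is always finite, so fset_set does not fall back to
   its default value. *)
Definition nb_eigenvalues (R : realType) (n : nat) (X : 'M[R[i]]_n) : nat :=
  #|` fset_set [set z : R[i] | eigenvalue X z]%classic |%N.

Definition min_nb_eigenvalues (R : realType) (n : nat) (A : 'M[R[i]]_n)
    (k : nat) : Prop :=
  (exists theta : R, nb_eigenvalues (herm_part (expi theta *: A)) = k) /\
  (forall theta : R, (k <= nb_eigenvalues (herm_part (expi theta *: A)))%N).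

Definition dichotomous (R : realType) (n : nat) (A : 'M[R[i]]_n) : Prop :=
  min_nb_eigenvalues A 2.

Definition essentially_hermitian (R : realType) (n : nat) (A : 'M[R[i]]_n) :
    Prop :=
  exists (H : 'M[R[i]]_n) (u v : R[i]),
    H \is hermsymmx /\ A = u *: H + v%:M.

(* ord_max is the last index, and lift ord_max embeds 'I_n as the n first
   indices of 'I_n.+1. *)
Definition arrowhead (R : realType) (n : nat) (a : 'I_n.+1 -> R[i])
    (b c : 'I_n -> R[i]) : 'M[R[i]]_n.+1 :=
  \matrix_(i, j)
    match unlift ord_max i, unlift ord_max j with
    | Some k, Some l => if k == l then a i else 0
    | Some k, None => b k
    | None, Some l => c l
    | None, None => a ord_max
    end.

Definition rot_re (R : realType) (theta : R) (z : R[i]) : R :=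
  complex.Re (expi (- theta) * z).

Definition arrowhead_cond_a (R : realType) (n : nat) (a : 'I_n.+1 -> R[i])
    (b c : 'I_n -> R[i]) (theta h0 h1 : R) : Prop :=
  [/\ forall j : 'I_n,
        arg_sum (b j) (c j) (2 * theta + pi) /\ `|b j| = `|c j|,
      forall j : 'I_n.+1, rot_re theta (a j) = h0 \/ rot_re theta (a j) = h1,
      exists j : 'I_n.+1, rot_re theta (a j) = h0
    & exists j : 'I_n.+1, rot_re theta (a j) = h1].

Definition arrowhead_cond_b (R : realType) (n : nat) (a : 'I_n.+1 -> R[i])
    (b c : 'I_n -> R[i]) (theta h0 h1 : R) : Prop :=
  exists i : 'I_n,
    (forall j : 'I_n, j != i ->
      [/\ arg_sum (b j) (c j) (2 * theta + pi),
          `|b j| = `|c j|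
        & rot_re theta (a (lift ord_max j)) = h0 \/
          rot_re theta (a (lift ord_max j)) = h1]) /\
    exists t : R,
      [/\ 0 < t < 1,
          rot_re theta (a (lift ord_max i)) = (1 - t) * h0 + t * h1,
          rot_re theta (a ord_max) = t * h0 + (1 - t) * h1
        & `|expi (- theta) * b i + expi theta * (c i)^*| =
            (2 * `|h1 - h0| * Num.sqrt (t * (1 - t)))%:C].

(* Main.v *)
Require Import Defs.
From mathcomp Require Import all_boot all_order all_algebra.
From mathcomp Require Import all_classical all_reals all_analysis.
From mathcomp Require Import ring lra finmap.

(** For a fixed angle, put H = herm_part (expi (- theta) *: A).  Three facts
    carry the equivalence.

    Hermitian matrices are unitarily diagonalizable with real spectrum, so the
    minimal polynomial of H is the product of the X - h over its distinct
    eigenvalues h.  Hence H has one eigenvalue exactly when it is a real scalar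
    matrix, and when it has two of them, h0 and h1, it satisfies
    (H - h0)(H - h1) = 0; conversely this equation leaves at most two
    eigenvalues.  As H is a real scalar matrix for some angle exactly when A is
    essentially Hermitian ([essentially_hermitianP]), A is dichotomous if and
    only if it is not essentially Hermitian and (H - h0)(H - h1) = 0 for some
    angle and some distinct reals h0, h1 ([dichotomousP]).

    When A is an arrowhead matrix, so is H: its diagonal entries are
    alpha_j = Re (e^(- i theta) a_j), and the entries beta_j of its last column
    are half of e^(- i theta) b_j + e^(i theta) c_j^*.  The off-diagonal
    entries beta_k beta_l^* of (H - h0)(H - h1) force all beta_j but at most
    one, beta_i say, to vanish; every index outside a nonzero beta_i then has
    its alpha in {h0, h1}, and a nonzero beta_i leaves a 2 x 2 block with
    eigenvalues h0 and h1, that is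
    alpha_i + alpha_n = h0 + h1 and
    |beta_i|^2 = (alpha_i - h0) (h1 - alpha_i)
    ([hermitian_arrowhead_annihilatedP]).

    These equations are the stated conditions in other coordinates.  By the
    polar form, beta_j = 0 says that arg b_j + arg c_j = 2 theta + pi and
    |b_j| = |c_j| ([arg_sum_cancelP]); and the 2 x 2 block is parametrized by
    t = (alpha_i - h0) / (h1 - h0) ([two_eigenvalue_blockP]).  In case (a), both
    values are attained because a diagonal H with a single diagonal value would
    be scalar. *)

Import Order.TTheory GRing.Theory Num.Theory.

(* Both scopes have a notation for conjugation.  With ring_scope on top it
   denotes the conjugation of closed fields, which herm_part is built on. *)
Local Open Scope ring_scope.
Local Open Scope complex_scope.
Local Open Scope ring_scope.

Set Implicit Arguments.
Unset Strict Implicit.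

(** * Phases and polar form *)

Section Phase.
Variable R : realType.
Implicit Types (x y : R) (z b c : R[i]).

Lemma expi0 : expi (0 : R) = 1.
Proof. by rewrite /expi cos0 sin0. Qed.

Lemma expi_pi : expi (pi : R) = -1.
Proof. by apply/eqP; rewrite eq_complex /= cospi sinpi oppr0 !eqxx. Qed.

Lemma expiD x y : expi (x + y) = expi x * expi y.
Proof.
by apply/eqP; rewrite eq_complex /= cosD sinD addrC eqxx addrC eqxx.
Qed.

Lemma expiNK x : expi x * expi (- x) = 1.
Proof. by rewrite -expiD subrr expi0. Qed.

Lemma conjCM (z w : R[i]) : (z * w)^* = z^* * w^*.
Proof. exact: rmorphM. Qed.

Lemma conj_expi x : (expi x)^* = expi (- x).
Proof. by rewrite /expi cosN sinN. Qed.

Lemma conj_expi_pihalf : (expi (pi / 2 : R))^* = - expi (pi / 2).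
Proof.
rewrite conj_expi /expi cosN sinN cos_pihalf.
by apply/eqP; rewrite eq_complex /= oppr0 !eqxx.
Qed.

Lemma norm_expi x : `|expi x| = 1.
Proof. by rewrite normc_def /= cos2Dsin2 sqrtr1. Qed.

Lemma expi_2pi_nat (m : nat) : expi (m%:R * (2 * pi) : R) = 1.
Proof.
have e2pi : expi (2 * pi : R) = 1.
  by rewrite mulr_natl mulr2n expiD expi_pi mulrNN mulr1.
elim: m => [|m IH]; first by rewrite mul0r expi0.
by rewrite -natr1 mulrDl mul1r expiD IH e2pi mulr1.
Qed.

Lemma expi_2pi (k : int) : expi (k%:~R * (2 * pi) : R) = 1.
Proof.
case: k => m; first exact: expi_2pi_nat.
by rewrite NegzE mulrNz mulNr -conj_expi expi_2pi_nat conjC1.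
Qed.

(** Reducing x modulo 2 pi to y with 0 <= y < 2 pi, the equality cos y = 1 makes the
    sine of y / 2 vanish by the duplication formula, hence y = 0. *)
Lemma expi_eq1 x : expi x = 1 -> exists k : int, x = k%:~R * (2 * pi).
Proof.
move=> x1; have pi_gt0 := pi_gt0 R.
have p2_gt0 : 0 < 2 * pi :> R by rewrite mulr_gt0.
set k := Num.floor (x / (2 * pi)); exists k.
pose y := x - k%:~R * (2 * pi).
have y_ge0 : 0 <= y by rewrite subr_ge0 -ler_pdivlMr // floor_le.
have y_lt : y < 2 * pi.
  have := floorD1_gt (x / (2 * pi)); rewrite ltr_pdivrMr // intrD mulrDl mul1r.
  by rewrite -/k addrC -ltrBlDr.
have cy : cos y = 1.
  have : expi y = 1.
    have := expiNK (k%:~R * (2 * pi)); rewrite expi_2pi mul1r => Nk.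
    by rewrite expiD x1 mul1r.
  by move=> [].
(* As 0 <= y / 2 < pi, the sine of y / 2 only vanishes when y does. *)
have : sin (y / 2) ^+ 2 = 0.
  have := cos_mulr2n (y / 2); rewrite -(mulr_natr (y / 2)) divfK // cy => c2.
  have := cos2Dsin2 (y / 2); lra.
move/eqP; rewrite sqrf_eq0 => /eqP s0.
have [y0|y_gt0] := eqVneq y 0; first by apply/eqP; rewrite -subr_eq0 -/y y0.
have : 0 < sin (y / 2).
  have {}y_gt0 : 0 < y by rewrite lt0r y_gt0.
  by apply: sin_gt0_pi; lra.
by rewrite s0 ltxx.
Qed.

Lemma eq_mod2piE x y : eq_mod2pi x y <-> expi x = expi y.
Proof.
split=> [[k ->]|xy]; first by rewrite expiD expi_2pi mulr1.
have /expi_eq1[k xyk] : expi (x - y) = 1 by rewrite expiD xy expiNK.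
by exists k; rewrite -xyk addrC subrK.
Qed.

(** The arccosine gives the cosine of [carg z]; its sine is then |Im z| / |z| up
    to sign, and the sign test in [carg] makes it Im z / |z|. *)
Lemma polar z : z = `|z| * expi (carg z).
Proof.
case: z => a b; have [->|z0] := eqVneq (a +i* b) 0.
  by rewrite normr0 mul0r.
rewrite /carg normc_def /=; set r := Num.sqrt _.
have r_gt0 : 0 < r.
  have: 0 < `|a +i* b| by rewrite normr_gt0.
  by rewrite normc_def ltcR.
have r2 : r ^+ 2 = a ^+ 2 + b ^+ 2 by rewrite sqr_sqrtr // addr_ge0 ?sqr_ge0.
have ab : (a / r) ^+ 2 + (b / r) ^+ 2 = 1.
  by rewrite !expr_div_n -mulrDl -r2 divff // expf_neq0 // gt_eqF.
have arB : -1 <= a / r <= 1.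
  rewrite -ler_norml -(@expr_le1 _ 2) // real_normK ?num_real //.
  by rewrite -ab lerDl sqr_ge0.
have sacos : sin (acos (a / r)) = `|b| / r.
  rewrite sin_acos // -ab addrC addKr sqrtr_sqr normrM (@gtr0_norm _ r^-1) //.
  by rewrite invr_gt0.
have rr : r / r = 1 by rewrite divff // gt_eqF.
have cacos := (acos_def arB).2.
apply/eqP; rewrite eq_complex /=; case: ifP => b0 /=.
  rewrite cacos sacos ger0_norm // !mul0r subr0 addr0 !(mulrCA r).
  by rewrite rr !mulr1 !eqxx.
rewrite cosN sinN cacos sacos ltr0_norm ?ltNge ?b0 // mulNr opprK.
by rewrite !mul0r subr0 addr0 !(mulrCA r) rr !mulr1 !eqxx.
Qed.

(** The cancellation reads b = - e^(2 i theta) c^*; comparing moduli and phases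
    of both sides gives the argument and modulus conditions. *)
Lemma arg_sum_cancelP theta b c :
  (arg_sum b c (2 * theta + pi) /\ `|b| = `|c|) <->
  expi (- theta) * b + expi theta * c^* = 0.
Proof.
have bE : (expi (- theta) * b + expi theta * c^* = 0) <->
          b = - (expi (2 * theta) * c^*).
  split=> [/eqP|->]; last first.
    rewrite mulrN mulrA -expiD addrC -[2]/(1 + 1) mulrDl mul1r addrA addNr.
    by rewrite add0r subrr.
  rewrite addr_eq0 => /eqP e.
  rewrite -[b]mul1r -(expiNK theta) -mulrA e mulrN mulrA -expiD.
  by rewrite -[2]/(1 + 1) mulrDl mul1r.
have cE : c^* = `|c| * expi (- carg c).
  rewrite {1}[c]polar conjCM conj_expi; congr (_ * _).
  by rewrite normc_def; exact: conjc_real.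
have xE : expi (2 * theta + pi) = - expi (2 * theta).
  by rewrite expiD expi_pi mulrN1.
rewrite bE; split=> [[[[-> ->]|[_ _ /eq_mod2piE arg_bc]] nbc]|bc].
- by rewrite conjC0 mulr0 oppr0.
- have eb : expi (carg b) = expi (carg b + carg c) * expi (- carg c).
    by rewrite -expiD addrK.
  by rewrite {1}[b]polar nbc eb arg_bc xE cE mulNr mulrN mulrCA.
- have nbc : `|b| = `|c|.
    by rewrite bc normrN normrM norm_expi mul1r norm_conjC.
  split=> //; have [c0|c0] := eqVneq c 0.
    by left; split=> //; apply/eqP; rewrite -normr_eq0 nbc c0 normr0.
  right; have b0 : b != 0 by rewrite -normr_eq0 nbc normr_eq0.
  split=> //; apply/eq_mod2piE; rewrite xE.
  move: bc; rewrite {1}[b]polar nbc cE => bc.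
  have nc0 : `|c| != 0 by rewrite normr_eq0.
  apply: (mulfI nc0); rewrite expiD mulrA bc mulNr -!mulrA.
  by rewrite (mulrC (expi (- carg c))) expiNK mulr1 mulrN (mulrC `|c|).
Qed.

End Phase.

(** * Eigenvalues of Hermitian matrices *)

Section Eigenvalues.
Variables (R : realType) (n : nat).
Implicit Types (X H : 'M[R[i]]_n.+1).

Lemma nb_eigenvaluesE X (rs : seq R[i]) :
  uniq rs -> eigenvalue X =i rs -> nb_eigenvalues X = size rs.
Proof.
move=> rs_uniq rsE; rewrite /nb_eigenvalues.
have -> : [set z | eigenvalue X z]%classic =
    [set` seq_fset tt rs]%classic.
  have memE z : (z \in seq_fset tt rs) = eigenvalue X z.
    by rewrite seq_fsetE -rsE.
  by apply/seteqP; split=> z zX; [have : z \in seq_fset tt rs by rewrite memE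
    | have : eigenvalue X z by rewrite -memE].
rewrite set_fsetK finmap.size_seq_fset undup_id //.
Qed.

(** Eigenvalues are roots of any annihilating polynomial. *)
Lemma nb_eigenvalues_lt_size X (p : {poly R[i]}) :
  p != 0 -> horner_mx X p = 0 -> (nb_eigenvalues X < size p)%N.
Proof.
move=> p0 Xp; have [rs mX] := closed_field_poly_normal (mxminpoly X).
rewrite (@nb_eigenvaluesE X (undup rs)) ?undup_uniq //; last first.
  move=> z; rewrite mem_undup -[LHS]/(eigenvalue X z) eigenvalue_root_min mX.
  rewrite (monicP (mxminpoly_monic X)) scale1r root_prod_XsubC //.
apply: max_poly_roots; rewrite ?undup_uniq //; apply/allP => z.
rewrite mem_undup -root_prod_XsubC -[X in root X]scale1r.
rewrite -(monicP (mxminpoly_monic X)) -mX.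
by move/(root_dvdp); apply; exact: mxminpoly_min.
Qed.

Lemma nb_eigenvalues_scalar X (z : R[i]) :
  X = z%:M -> (nb_eigenvalues X <= 1)%N.
Proof.
move=> Xz; rewrite -ltnS -[2%N](size_XsubC z).
apply: nb_eigenvalues_lt_size; first by rewrite polyXsubC_eq0.
by rewrite rmorphB /= horner_mx_X horner_mx_C Xz subrr.
Qed.

Lemma nb_eigenvalues_quadratic X (z w : R[i]) :
  (X - z%:M) *m (X - w%:M) = 0 -> (nb_eigenvalues X <= 2)%N.
Proof.
move=> Xzw; rewrite -ltnS.
have <- : size (('X - z%:P) * ('X - w%:P)) = 3%N.
  by rewrite size_monicM ?monicXsubC ?polyXsubC_eq0 ?size_XsubC.
apply: nb_eigenvalues_lt_size; first by rewrite mulf_neq0 ?polyXsubC_eq0.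
by rewrite rmorphM !rmorphB /= horner_mx_X !horner_mx_C.
Qed.

(** By the spectral theorem the minimal polynomial has simple real roots; its
    roots are the eigenvalues, and it annihilates the matrix. *)
Lemma hermitian_annihilator H : H \is hermsymmx ->
  exists rs : seq R, [/\ uniq rs, nb_eigenvalues H = size rs
    & horner_mx H (\prod_(r <- rs) ('X - (r%:C)%:P)) = 0].
Proof.
move=> Hh; have Hn := hermitian_normalmx Hh.
have Hr := hermitian_spectral_diag_real Hh.
set d := spectral_diag H in Hr.
set zs := undup [seq d 0 i | i <- enum 'I_n.+1].
have mH : mxminpoly H = \prod_(z <- zs) ('X - z%:P).
  have -> : H = conjmx (invmx (spectralmx H)) (diag_mx d).
    rewrite conjumx ?unitmx_inv ?spectral_unit // invmxK.
    exact: orthomx_spectralP.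
  by rewrite mxminpoly_uconj ?unitmx_inv ?spectral_unit // mxminpoly_diag.
have zs_real z : z \in zs -> (complex.Re z)%:C = z.
  by rewrite mem_undup => /mapP[i _ ->]; rewrite RRe_real // (mxOverP Hr).
exists [seq complex.Re z | z <- zs]; split.
- rewrite map_inj_in_uniq ?undup_uniq // => z w z_in w_in Re_zw.
  by rewrite -(zs_real z) // -(zs_real w) // Re_zw.
- rewrite size_map; apply: nb_eigenvaluesE; first exact: undup_uniq.
  move=> z; rewrite -[LHS]/(eigenvalue H z) eigenvalue_root_min mH.
  by rewrite root_prod_XsubC.
- rewrite big_map -[RHS](mx_root_minpoly H) mH; congr horner_mx.
  rewrite [LHS]big_seq_cond [RHS]big_seq_cond; apply: eq_bigr => z.
  by rewrite andbT => /zs_real ->.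
Qed.

Lemma hermitian_nb_eigenvalues_gt1 H : H \is hermsymmx ->
  (2 <= nb_eigenvalues H)%N <-> ~ exists h : R, H = (h%:C)%:M.
Proof.
move=> Hh; split=> [H2 [h /nb_eigenvalues_scalar]|Hns].
  by rewrite leqNgt H2.
have [[|r [|? ?]] [_ -> //]] := hermitian_annihilator Hh.
  by rewrite big_nil rmorph1 => /eqP; rewrite oner_eq0.
rewrite big_seq1 rmorphB /= horner_mx_X horner_mx_C => /eqP.
by rewrite subr_eq0 => /eqP Hr; case: Hns; exists r.
Qed.

Lemma hermitian_nb_eigenvalues2 H : H \is hermsymmx ->
  nb_eigenvalues H = 2 ->
  exists h0 h1 : R, h0 <> h1 /\ (H - (h0%:C)%:M) *m (H - (h1%:C)%:M) = 0.
Proof.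
move=> Hh; have [rs [rs_uniq -> Hrs]] := hermitian_annihilator Hh.
case: rs rs_uniq Hrs => [|h0 [|h1 [|//]]] //= rs_uniq Hrs _.
exists h0, h1; split; first by move=> e; move: rs_uniq; rewrite e inE eqxx.
move: Hrs; rewrite big_cons big_seq1 rmorphM !rmorphB /=.
by rewrite horner_mx_X !horner_mx_C.
Qed.

End Eigenvalues.

(** * Hermitian parts and essentially Hermitian matrices *)

Section HermitianPart.
Variables (R : realType) (n : nat).
Implicit Types (X H : 'M[R[i]]_n.+1).

Lemma scalemx_entry (z : R[i]) X i j : (z *: X) i j = z * X i j.
Proof. by rewrite mxE. Qed.

Lemma sub_scalar_entry X (z : R[i]) i j :
  (X - z%:M) i j = X i j - z *+ (i == j).
Proof. by rewrite !mxE. Qed.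

Lemma herm_part_entry X i j : herm_part X i j = (X i j + (X j i)^*) / 2.
Proof. by rewrite !mxE mulrC. Qed.

Lemma hermsymmx_entryP H : H \is hermsymmx <-> forall i j, H i j = (H j i)^*.
Proof.
split=> [/is_hermitianmxP HE i j|HE]; first by rewrite {1}HE expr0 scale1r !mxE.
by apply/is_hermitianmxP/matrixP => i j; rewrite expr0 scale1r !mxE HE.
Qed.

Lemma herm_part_hermsymmx X : herm_part X \is hermsymmx.
Proof.
apply/hermsymmx_entryP => i j; rewrite !herm_part_entry.
by rewrite conjCM rmorphD /= conjCK fmorphV rmorph_nat addrC.
Qed.

(** A skew-Hermitian matrix is i times a Hermitian one, and taking the Hermitian
    part cancels it; so both sides say that some rotation of X is a
    skew-Hermitian matrix plus a scalar. *)
Lemma essentially_hermitianP X :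
  essentially_hermitian X <->
  exists theta h : R, herm_part (expi theta *: X) = (h%:C)%:M.
Proof.
pose w : R[i] := expi (pi / 2).
split=> [[H [u [v [/hermsymmx_entryP HE XE]]]]|[theta [h hX]]].
  (* This angle turns u into the imaginary number i |u|, so that the rotation
     of u *: H is skew-Hermitian. *)
  pose theta := pi / 2 - carg u; pose z := expi theta * v.
  exists theta, (complex.Re z); apply/matrixP => i j.
  have wu : expi theta * u = `|u| * w.
    by rewrite {1}[u]polar mulrCA -expiD subrK.
  have nu : `|u|^* = `|u| by rewrite conj_normC.
  have ZE k l : (expi theta *: X) k l = `|u| * w * H k l + z *+ (k == l).
    by rewrite XE !mxE mulrDr mulrA wu mulrnAr.
  rewrite herm_part_entry !ZE rmorphD /= !conjCM nu conj_expi_pihalf -/w.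
  rewrite -HE mxE eq_sym.
  have zE : (z + z^*) / 2 = (complex.Re z)%:C by rewrite ReJ_add.
  by case: eqP => _; rewrite ?mulr1n ?mulr0n ?conjC0 -?zE; field.
pose K := - w *: (expi theta *: X - (h%:C)%:M).
exists K, (expi (- theta) * w), (expi (- theta) * h%:C); split.
  apply/hermsymmx_entryP => i j.
  have := congr1 (fun M : 'M[R[i]]_n.+1 => M i j) hX.
  rewrite herm_part_entry => hij.
  rewrite !scalemx_entry !sub_scalar_entry.
  set Y := expi theta *: X in hij *.
  have -> : Y i j = 2 * (h%:C)%:M i j - (Y j i)^*.
    by rewrite -hij; field.
  rewrite conjCM rmorphB rmorphN /= conj_expi_pihalf opprK -/w rmorphMn /=.
  have -> : (h%:C)^* = h%:C by exact: conjc_real.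
  by rewrite mxE eq_sym; ring.
have ww : w * w = -1 by rewrite -expiD -splitr expi_pi.
have -> : (expi (- theta) * w) *: K =
    expi (- theta) *: (expi theta *: X - (h%:C)%:M).
  by rewrite /K scalerA mulrN -mulrA ww mulrN1 opprK.
rewrite -scale_scalar_mx -scalerDr subrK scalerA mulrC.
by rewrite expiNK scale1r.
Qed.

(** If no Hermitian part is scalar, each has at least two eigenvalues, so that
    the minimum is two as soon as one of them has at most two. *)
Lemma dichotomousP X :
  dichotomous X <->
  ~ essentially_hermitian X /\
  exists theta h0 h1 : R, h0 <> h1 /\
    (herm_part (expi (- theta) *: X) - (h0%:C)%:M) *m
    (herm_part (expi (- theta) *: X) - (h1%:C)%:M) = 0.
Proof.
split=> [[[theta nb2] nb_ge2]|[nessX [theta [h0 [h1 [_ quad]]]]]].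
  split.
    move/essentially_hermitianP=> [phi [h hX]].
    have /(hermitian_nb_eigenvalues_gt1 (herm_part_hermsymmx _)) := nb_ge2 phi.
    by apply; exists h.
  have [h0 [h1 [h01 quad]]] :=
    hermitian_nb_eigenvalues2 (herm_part_hermsymmx _) nb2.
  by exists (- theta), h0, h1; rewrite opprK.
have nb_ge2 phi : (2 <= nb_eigenvalues (herm_part (expi phi *: X)))%N.
  apply/(hermitian_nb_eigenvalues_gt1 (herm_part_hermsymmx _)) => -[h hX].
  by apply: nessX; apply/essentially_hermitianP; exists phi, h.
split=> //; exists (- theta); apply/eqP.
by rewrite eqn_leq nb_ge2 andbT; exact: nb_eigenvalues_quadratic quad.
Qed.

End HermitianPart.

(** * Arrowhead matrices *)

Section Arrowhead.
Variables (R : realType) (n : nat).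
Implicit Types (a : 'I_n.+1 -> R[i]) (b c : 'I_n -> R[i]).
Implicit Types (alpha : 'I_n.+1 -> R) (beta : 'I_n -> R[i]).

Lemma arrowhead_ll a b c k l :
  arrowhead a b c (lift ord_max k) (lift ord_max l) =
  if k == l then a (lift ord_max k) else 0.
Proof. by rewrite mxE !liftK. Qed.

Lemma arrowhead_lm a b c k : arrowhead a b c (lift ord_max k) ord_max = b k.
Proof. by rewrite mxE liftK unlift_none. Qed.

Lemma arrowhead_ml a b c l : arrowhead a b c ord_max (lift ord_max l) = c l.
Proof. by rewrite mxE liftK unlift_none. Qed.

Lemma arrowhead_mm a b c : arrowhead a b c ord_max ord_max = a ord_max.
Proof. by rewrite mxE unlift_none. Qed.

Definition arrowheadE :=
  (arrowhead_ll, arrowhead_lm, arrowhead_ml, arrowhead_mm).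

Lemma arrowhead_matrixP (A B : 'M[R[i]]_n.+1) :
  [/\ forall k l,
       A (lift ord_max k) (lift ord_max l) = B (lift ord_max k) (lift ord_max l),
     forall k, A (lift ord_max k) ord_max = B (lift ord_max k) ord_max,
     forall l, A ord_max (lift ord_max l) = B ord_max (lift ord_max l) &
     A ord_max ord_max = B ord_max ord_max] -> A = B.
Proof.
case=> ll lm ml mm; apply/matrixP => i j.
by case: (unliftP ord_max i) => [k ->|->];
  case: (unliftP ord_max j) => [l ->|->].
Qed.

Lemma arrowhead_subM a b c (z : R[i]) :
  arrowhead a b c - z%:M = arrowhead (fun j => a j - z) b c.
Proof.
apply: arrowhead_matrixP; split=> [k l|k|l|];
  rewrite sub_scalar_entry !arrowheadE ?subr0 ?eqxx //.
- rewrite (inj_eq lift_inj); case: eqP => _ //; exact: subr0.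
- by rewrite eq_sym (negPf (neq_lift _ _)) subr0.
- by rewrite (negPf (neq_lift _ _)) subr0.
Qed.

Lemma arrowhead_scalar z :
  arrowhead (fun=> z) (fun=> 0) (fun=> 0) = z%:M :> 'M[R[i]]_n.+1.
Proof.
by apply/eqP; rewrite -subr_eq0 arrowhead_subM subrr; apply/eqP/matrixP => i j;
  rewrite !mxE; case: unlift => [k|]; case: unlift => [l|]; rewrite ?if_same.
Qed.

Section Mul.
Variables (a a' : 'I_n.+1 -> R[i]) (b c b' c' : 'I_n -> R[i]).
Let A := arrowhead a b c.
Let A' := arrowhead a' b' c'.

Lemma arrowhead_mul_ll k l :
  (A *m A') (lift ord_max k) (lift ord_max l) =
  (if k == l then a (lift ord_max k) * a' (lift ord_max k) else 0) + b k * c' l.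
Proof.
rewrite mxE (bigD1_ord ord_max) //= !arrowheadE addrC; congr (_ + _).
rewrite (bigD1 k) //= !arrowheadE eqxx big1 ?addr0 => [|m mk].
  by case: eqP => _; rewrite ?mulr0.
by rewrite arrowheadE eq_sym (negPf mk) mul0r.
Qed.

Lemma arrowhead_mul_lm k :
  (A *m A') (lift ord_max k) ord_max =
  a (lift ord_max k) * b' k + b k * a' ord_max.
Proof.
rewrite mxE (bigD1_ord ord_max) //= !arrowheadE addrC; congr (_ + _).
rewrite (bigD1 k) //= !arrowheadE eqxx big1 ?addr0 // => m mk.
by rewrite arrowheadE eq_sym (negPf mk) mul0r.
Qed.

Lemma arrowhead_mul_ml l :
  (A *m A') ord_max (lift ord_max l) =
  c l * a' (lift ord_max l) + a ord_max * c' l.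
Proof.
rewrite mxE (bigD1_ord ord_max) //= !arrowheadE addrC; congr (_ + _).
rewrite (bigD1 l) //= !arrowheadE eqxx big1 ?addr0 // => m ml.
by rewrite !arrowheadE (negPf ml) mulr0.
Qed.

Lemma arrowhead_mul_mm :
  (A *m A') ord_max ord_max = \sum_k c k * b' k + a ord_max * a' ord_max.
Proof.
rewrite mxE (bigD1_ord ord_max) //= !arrowheadE addrC; congr (_ + _).
by apply: eq_bigr => m _; rewrite !arrowheadE.
Qed.
End Mul.

Definition hermitian_arrowhead alpha beta : 'M[R[i]]_n.+1 :=
  arrowhead (fun j => (alpha j)%:C) beta (fun j => (beta j)^*).

Lemma herm_part_arrowhead theta a b c :
  herm_part (expi (- theta) *: arrowhead a b c) =
  hermitian_arrowhead (fun j => rot_re theta (a j))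
    (fun j => (expi (- theta) * b j + expi theta * (c j)^*) / 2).
Proof.
have diag (z : R[i]) : (z + z^*) / 2 = (complex.Re z)%:C by rewrite ReJ_add.
apply: arrowhead_matrixP; split=> [k l|k|l|];
  rewrite /hermitian_arrowhead herm_part_entry !scalemx_entry !arrowheadE.
- have [->|kl] := eqVneq k l; first by rewrite diag.
  by rewrite mulr0 conjC0 addr0 mul0r.
- by rewrite conjCM conj_expi opprK.
- rewrite !conjCM rmorphD /= !conjCM !conj_expi opprK conjCK addrC.
  by rewrite fmorphV rmorph_nat.
- by rewrite diag.
Qed.

(** The entry (k, l) of the product, for distinct k and l before the last index,
    is beta_k beta_l^*, so at most one beta_i is nonzero.  The other entries are
    those of the diagonal part and of the 2 x 2 block on i and the last index;
    the latter is annihilated exactly when its trace is h0 + h1 and its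
    determinant is h0 h1. *)
Lemma hermitian_arrowhead_annihilatedP alpha beta (h0 h1 : R) :
  (hermitian_arrowhead alpha beta - (h0%:C)%:M) *m
  (hermitian_arrowhead alpha beta - (h1%:C)%:M) = 0 <->
  ((forall k, beta k = 0) /\ (forall j, alpha j = h0 \/ alpha j = h1)) \/
  (exists i,
    [/\ forall j, j != i -> beta j = 0 /\
        (alpha (lift ord_max j) = h0 \/ alpha (lift ord_max j) = h1),
      beta i <> 0,
      alpha (lift ord_max i) + alpha ord_max = h0 + h1 &
      `|beta i| ^+ 2 = ((alpha (lift ord_max i) - h0) *
                        (h1 - alpha (lift ord_max i)))%:C]).
Proof.
have quadP x : (x%:C - h0%:C) * (x%:C - h1%:C) = 0 <-> x = h0 \/ x = h1.
  split=> [/eqP|[]->]; rewrite ?subrr ?mulr0 ?mul0r //.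
  by rewrite mulf_eq0 !subr_eq0 => /orP[] /eqP/complexI; [left|right].
rewrite /hermitian_arrowhead !arrowhead_subM; split=> [M0|].
  (* The entries of the product, called ll, lm or mm according to whether the
     row and the column come before the last one (l) or are the last one (m). *)
  have ll k l : beta k * (beta l)^* =
      - (if k == l then ((alpha (lift ord_max k))%:C - h0%:C) *
                        ((alpha (lift ord_max k))%:C - h1%:C) else 0).
    have := congr1
      (fun M : 'M[R[i]]_n.+1 => M (lift ord_max k) (lift ord_max l)) M0.
    by rewrite arrowhead_mul_ll mxE => /eqP; rewrite addrC addr_eq0 => /eqP.
  have lm k : ((alpha (lift ord_max k))%:C - h0%:C) * beta k +
              beta k * ((alpha ord_max)%:C - h1%:C) = 0.
    have := congr1 (fun M : 'M[R[i]]_n.+1 => M (lift ord_max k) ord_max) M0.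
    by rewrite arrowhead_mul_lm mxE.
  have mm : \sum_k (beta k)^* * beta k +
      ((alpha ord_max)%:C - h0%:C) * ((alpha ord_max)%:C - h1%:C) = 0.
    have := congr1 (fun M : 'M[R[i]]_n.+1 => M ord_max ord_max) M0.
    by rewrite arrowhead_mul_mm mxE.
  have beta0 k : beta k = 0 ->
      alpha (lift ord_max k) = h0 \/ alpha (lift ord_max k) = h1.
    move=> bk; apply/quadP; have := ll k k; rewrite eqxx bk mul0r => /eqP.
    by rewrite eq_sym oppr_eq0 => /eqP.
  have [/existsP[i bi]|/existsPn b0] := boolP [exists k, beta k != 0].
    right; exists i; split=> [j ji|||].
    - have bj : beta j = 0.
        have := ll j i; rewrite (negPf ji) oppr0 => /eqP.
        by rewrite mulf_eq0 conjC_eq0 (negPf bi) orbF => /eqP.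
      by split; last exact: beta0.
    - exact/eqP.
    - have := lm i; rewrite [X in _ + X]mulrC -mulrDl => /eqP.
      rewrite mulf_eq0 (negPf bi) orbF -!rmorphB -rmorphD /=.
      rewrite -[0]/(0%:C) => /eqP/complexI s0.
      by apply/eqP; rewrite -subr_eq0 -s0; apply/eqP; ring.
    - rewrite normCK ll eqxx rmorphM !rmorphB /=; ring.
  left; have {}b0 k : beta k = 0 by apply/eqP; rewrite -[_ == _]negbK b0.
  split=> // j; case: (unliftP ord_max j) => [k ->|->]; first exact: beta0.
  by apply/quadP; rewrite -mm big1 ?add0r // => k _; rewrite b0 mulr0.
case=> [[b0 a01]|[i [off _ sum nb]]].
  apply: arrowhead_matrixP; split=> [k l|k|l|]; rewrite ?arrowhead_mul_ll
    ?arrowhead_mul_lm ?arrowhead_mul_ml ?arrowhead_mul_mm mxE.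
  - rewrite b0 mul0r addr0; case: eqP => // _; exact/quadP.
  - by rewrite b0 mul0r mulr0 addr0.
  - by rewrite b0 conjC0 mul0r mulr0 addr0.
  - rewrite big1 => [|k _]; last by rewrite b0 mulr0.
    by rewrite add0r; apply/quadP.
have an : alpha ord_max = h0 + h1 - alpha (lift ord_max i).
  by rewrite -sum addrC addKr.
move: nb; rewrite normCK rmorphM !rmorphB /= => nb.
apply: arrowhead_matrixP; split=> [k l|k|l|]; rewrite ?arrowhead_mul_ll
  ?arrowhead_mul_lm ?arrowhead_mul_ml ?arrowhead_mul_mm mxE.
- have [->|ki] := eqVneq k i; have [li|li] := eqVneq l i.
  + rewrite li nb /=; ring.
  + by rewrite (off l li).1 conjC0 mulr0 addr0.
  + by rewrite li (negPf ki) (off k ki).1 mul0r addr0.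
  + rewrite (off k ki).1 mul0r addr0; case: eqP => // _.
    by apply/quadP; exact: (off k ki).2.
- have [->|ki] := eqVneq k i; last by rewrite (off k ki).1 mul0r mulr0 addr0.
  by rewrite an !rmorphB rmorphD /=; ring.
- have [->|li] := eqVneq l i.
    by rewrite an !rmorphB rmorphD /=; ring.
  by rewrite (off l li).1 conjC0 mul0r mulr0 addr0.
- rewrite (bigD1 i) //= big1 => [|k ki]; last by rewrite (off k ki).1 mulr0.
  by rewrite mulrC nb an !rmorphB rmorphD /=; ring.
Qed.

End Arrowhead.

(** * Back to the conditions on the entries *)

(** A Hermitian 2 x 2 block with diagonal (x, y) and off-diagonal entry w / 2
    has eigenvalues h0 and h1 when its trace and determinant are right.  The
    parameter t is the position of x between h0 and h1; then
    (x - h0) (h1 - x) = (h1 - h0)^2 t (1 - t), so a nonzero w forces t to lie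
    strictly between 0 and 1. *)
Lemma two_eigenvalue_blockP (R : realType) (h0 h1 x y : R) (w : R[i]) :
  h0 <> h1 ->
  (exists t : R, [/\ 0 < t < 1, x = (1 - t) * h0 + t * h1,
     y = t * h0 + (1 - t) * h1
     & `|w| = (2 * `|h1 - h0| * Num.sqrt (t * (1 - t)))%:C]) <->
  [/\ w <> 0, x + y = h0 + h1 & `|w / 2| ^+ 2 = ((x - h0) * (h1 - x))%:C].
Proof.
move=> /eqP h01; have d0 : h1 - h0 != 0 by rewrite subr_eq0 eq_sym.
have d2 : 0 < (h1 - h0) ^+ 2 by rewrite lt0r sqrf_eq0 d0 sqr_ge0.
split=> [[t [t01 -> -> nw]]|[w0 xy nw]].
  have t_gt0 : 0 < t * (1 - t) by rewrite mulr_gt0 ?subr_gt0; case/andP: t01.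
  split; last 2 first.
  - ring.
  - rewrite normrM normfV normr_nat expr_div_n nw -!rmorphXn /= !exprMn.
    rewrite sqr_sqrtr ?ltW // real_normK ?num_real //.
    rewrite -(rmorph_nat (real_complex R)) -rmorphXn -fmorphV -rmorphM /=.
    by congr (_%:C); field.
  move=> w0; move: nw; rewrite w0 normr0 -[0]/(0%:C) => /complexI/eqP.
  rewrite eq_sym !mulf_eq0 sqrtr_eq0 leNgt t_gt0 normr_eq0 (negPf d0).
  by rewrite orbF pnatr_eq0.
pose t := (x - h0) / (h1 - h0); exists t.
have xt : x = (1 - t) * h0 + t * h1 by rewrite /t; field.
have yt : y = t * h0 + (1 - t) * h1.
  by apply: (addrI x); rewrite xy xt; ring.
have xx : (x - h0) * (h1 - x) = (h1 - h0) ^+ 2 * (t * (1 - t)).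
  by rewrite xt; ring.
have tt : 0 < t * (1 - t).
  rewrite -(pmulr_rgt0 _ d2) -xx -ltcR -nw exprn_gt0 // normr_gt0.
  by rewrite mulf_neq0 ?invr_eq0 ?pnatr_eq0 //; exact/eqP.
split=> //; first by nra.
have s_ge0 : 0 <= `|h1 - h0| * Num.sqrt (t * (1 - t)).
  by rewrite mulr_ge0 ?sqrtr_ge0.
have : `|w / 2| ^+ 2 == (`|h1 - h0| * Num.sqrt (t * (1 - t)))%:C ^+ 2.
  by rewrite nw xx -rmorphXn /= exprMn real_normK ?num_real // sqr_sqrtr // ltW.
rewrite eqrXn2 ?normr_ge0 ?ler0c // => /eqP.
rewrite normrM normfV normr_nat => nw2.
have -> : `|w| = 2 * (`|w| / 2) by field.
by rewrite nw2 -mulrA [in RHS]rmorphM /= rmorph_nat.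
Qed.

Section Conditions.
Variables (R : realType) (n : nat).
Variables (a : 'I_n.+1 -> R[i]) (b c : 'I_n -> R[i]).

Lemma arrowhead_cond_annihilated (theta h0 h1 : R) : h0 <> h1 ->
  arrowhead_cond_a a b c theta h0 h1 \/ arrowhead_cond_b a b c theta h0 h1 ->
  (herm_part (expi (- theta) *: arrowhead a b c) - (h0%:C)%:M) *m
  (herm_part (expi (- theta) *: arrowhead a b c) - (h1%:C)%:M) = 0.
Proof.
move=> h01 cond; rewrite herm_part_arrowhead.
apply/hermitian_arrowhead_annihilatedP.
case: cond => [[bc ah _ _]|[i [off t_i]]]; [left|right].
  by split=> // k; have /arg_sum_cancelP -> := bc k; rewrite mul0r.
have [w0 sum nw] := (two_eigenvalue_blockP _ _ _ h01).1 t_i.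
exists i; split=> // [j ji|/eqP].
  have [arg_bc nbc aj] := off j ji; split=> //.
  by have /arg_sum_cancelP -> := conj arg_bc nbc; rewrite mul0r.
by rewrite mulf_eq0 invr_eq0 pnatr_eq0 orbF => /eqP.
Qed.

Lemma annihilated_arrowhead_cond (theta h0 h1 : R) : h0 <> h1 ->
  ~ essentially_hermitian (arrowhead a b c) ->
  (herm_part (expi (- theta) *: arrowhead a b c) - (h0%:C)%:M) *m
  (herm_part (expi (- theta) *: arrowhead a b c) - (h1%:C)%:M) = 0 ->
  arrowhead_cond_a a b c theta h0 h1 \/ arrowhead_cond_b a b c theta h0 h1.
Proof.
move=> h01 ness; rewrite herm_part_arrowhead.
move=> /hermitian_arrowhead_annihilatedP.
have half0 k : (expi (- theta) * b k + expi theta * (c k)^*) / 2 = 0 ->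
    arg_sum (b k) (c k) (2 * theta + pi) /\ `|b k| = `|c k|.
  move=> /eqP; rewrite mulf_eq0 invr_eq0 pnatr_eq0 orbF => /eqP.
  by move/arg_sum_cancelP.
(* A diagonal Hermitian part with a single diagonal value is scalar. *)
have not_all h :
    (forall k, (expi (- theta) * b k + expi theta * (c k)^*) / 2 = 0) ->
    ~ forall j, rot_re theta (a j) = h.
  move=> b0 ah; apply: ness; apply/essentially_hermitianP; exists (- theta), h.
  rewrite herm_part_arrowhead /hermitian_arrowhead -arrowhead_scalar.
  apply: arrowhead_matrixP; split=> [k l|k|l|]; rewrite !arrowheadE ?ah ?b0 //.
  exact: conjC0.
case=> [[b0 ah]|[i [off bi sum nb]]]; [left|right].
  split=> // [j||]; first exact: half0.
    apply: contrapT => no_h0; apply: (not_all h1) => // j.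
    by have [aj|//] := ah j; case: no_h0; exists j.
  apply: contrapT => no_h1; apply: (not_all h0) => // j.
  by have [//|aj] := ah j; case: no_h1; exists j.
exists i; split.
  by move=> j /off[/half0[arg_bc nbc] aj].
apply/two_eigenvalue_blockP => //; split=> // w0.
by apply: bi; rewrite w0 mul0r.
Qed.

End Conditions.

Theorem proposition5 (R : realType) (n : nat) (hn : (3 <= n.+1)%N)
    (a : 'I_n.+1 -> R[i]) (b c : 'I_n -> R[i]) :
  dichotomous (arrowhead a b c) <->
  ~ essentially_hermitian (arrowhead a b c) /\
  exists theta h0 h1 : R,
    h0 <> h1 /\
    (arrowhead_cond_a a b c theta h0 h1 \/
     arrowhead_cond_b a b c theta h0 h1).
Proof.
rewrite dichotomousP; split=> -[ness [theta [h0 [h1 [h01 cond]]]]].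
  split=> //; exists theta, h0, h1; split=> //.
  exact: annihilated_arrowhead_cond.
split=> //; exists theta, h0, h1; split=> //.
exact: arrowhead_cond_annihilated.
Qed.
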